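(* Let $r=\nu\delta^{\tau}$ and $r'=\nu'\delta^{\tau'}$ be monomials. The following rule holds: $$r\odot^\flat r'=\begin{cases}(\nu-\nu')\,\delta^{\tau} & \text{if }\tau\le\tau',\\ \text{undefined} & \text{otherwise,}\end{cases}$$ with the convention that $+\infty-\infty=+\infty$.
   Context: Let $\overline{\mathbb Z}=\mathbb Z\cup\{-\infty,+\infty\}$ with its standard order. A counter is a map $s:\overline{\mathbb Z}\to\overline{\mathbb Z}$ that is non-decreasing for the standard order and satisfies $s(-\infty)=-\infty$, $s(+\infty)=+\infty$; $\Sigma$ is the set of counters. Thus a counter is determined by its values on $\mathbb Z$. The order on $\Sigma$ is $s\preceq s'$ iff $s(t)\ge s'(t)$ (standard order, reversed) for all $t\in\mathbb Z$. The counter $s_\varepsilon$ is the one equal to $+\infty$ on all of $\mathbb Z$. The Hadamard product of $s_1,s_2\in\Sigma$ is the counter $s_1\odot s_2$ with $(s_1\odot s_2)(t)=s_1(t)+s_2(t)$ for all $t\in\mathbb Z$, where in this sum $(+\infty)+(-\infty)=+\infty$. Dual residual: for $a\in\Sigma$ let $\mathcal D_a=\{x\in\Sigma : x=s_\varepsilon\text{ if there is }t\in\mathbb Z\text{ with }a(t)=-\infty\}$ and $\mathcal C_a=\{y\in\Sigma : y(t)=+\infty\text{ for all }t\in\mathbb Z\text{ with }a(t)\in\{-\infty,+\infty\}\}$. The map $\mathcal D_a\to\mathcal C_a$, $x\mapsto a\odot x$, is dually residuated; its dual residual is written $y\mapsto y\odot^\flat a$, and for $y\in\mathcal C_a$,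 $y\odot^\flat a$ is the least (for $\preceq$) counter $x\in\Sigma$ such that $a\odot x\succeq y$. For $y\notin\mathcal C_a$, $y\odot^\flat a$ is not defined. A monomial $n\delta^{t_0}$ (with coefficient $n\in\overline{\mathbb Z}$ and exponent $t_0\in\overline{\mathbb Z}$) denotes the counter with value $n$ at every $t\in\mathbb Z$ with $t\le t_0$ and $+\infty$ at every $t\in\mathbb Z$ with $t>t_0$. The convention in the claim says how to interpret the standard subtraction $\nu-\nu'$ when the coefficients are infinite.
   Formalization: Two families where the rule fails are excluded: ν = +∞ with τ > τ' (then r = s_ε and the residual is defined), and τ ≤ τ' with τ > −∞, ν ≠ +∞ and ν' infinite (then r is outside the domain and the residual is undefined). *)

(* Defs.v *)
From HB Require Import structures.
From mathcomp Require Import all_boot all_order all_algebra.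
From mathcomp Require Import boolp classical_sets constructive_ereal.

Set Implicit Arguments.
Unset Strict Implicit.
Unset Printing Implicit Defensive.

Import Order.TTheory GRing.Theory Num.Theory.

Local Open Scope classical_set_scope.
Local Open Scope ereal_scope.

Record counter := Counter {
  counter_fun :> \bar int -> \bar int;
  counter_nondecreasing : forall t u, t <= u -> counter_fun t <= counter_fun u;
  counterNy : counter_fun -oo = -oo;
  countery : counter_fun +oo = +oo }.

(* The order on counters is the reverse of the pointwise order. *)
Definition counter_le (s1 s2 : counter) : Prop :=
  forall t : int, s2 t%:E <= s1 t%:E.

(* [%dE] is the addition of [\bar int] with (+oo) + (-oo) = +oo (with [%E] this
   sum would be -oo). *)
Definition hadamard_fun (s1 s2 : counter) (t : \bar int) : \bar int :=
  (s1 t + s2 t)%dE.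

Lemma hadamard_nondecreasing (s1 s2 : counter) (t u : \bar int) :
  t <= u -> hadamard_fun s1 s2 t <= hadamard_fun s1 s2 u.
Proof.
by move=> tu; apply: DualAddTheoryRealDomain.lee_dD; exact: counter_nondecreasing.
Qed.

Lemma hadamardNy (s1 s2 : counter) : hadamard_fun s1 s2 -oo = -oo.
Proof. by rewrite /hadamard_fun !counterNy. Qed.

Lemma hadamardy (s1 s2 : counter) : hadamard_fun s1 s2 +oo = +oo.
Proof. by rewrite /hadamard_fun !countery. Qed.

Definition hadamard (s1 s2 : counter) : counter :=
  Counter (@hadamard_nondecreasing s1 s2) (hadamardNy s1 s2) (hadamardy s1 s2).

Definition monomial_fun (n t0 t : \bar int) : \bar int :=
  match t with
  | -oo => -oo
  | +oo => +oo
  | k%:E => if k%:E <= t0 then n else +oo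
  end.

Lemma monomial_nondecreasing (n t0 t u : \bar int) :
  t <= u -> monomial_fun n t0 t <= monomial_fun n t0 u.
Proof.
case: t => [t||]; case: u => [u||] //=; rewrite ?leey ?leNye //.
move=> tu; case: (boolP (u%:E <= t0)) => ut0; last exact: leey.
by rewrite (le_trans tu ut0).
Qed.

Definition monomial (n t0 : \bar int) : counter :=
  Counter (@monomial_nondecreasing n t0) (erefl : monomial_fun n t0 -oo = -oo)
          (erefl : monomial_fun n t0 +oo = +oo).

(* The set C_a, domain of y |-> y (.)^flat a. *)
Definition dual_residual_dom (a : counter) : set counter :=
  [set y : counter | forall t : int,
     a t%:E = -oo \/ a t%:E = +oo -> y t%:E = +oo].

Definition is_dual_residual (y a x : counter) : Prop :=
  counter_le y (hadamard a x) /\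
  forall z : counter, counter_le y (hadamard a z) -> counter_le x z.

Lemma bar_int_lub (S : set (\bar int)) :
  exists m, (forall x, S x -> x <= m) /\
            (forall u, (forall x, S x -> x <= u) -> m <= u).
Proof.
have [[B SB]|unbd] := pselect (exists B : int, forall x, S x -> x <= B%:E);
  last first.
  exists +oo; split=> [x _|[u||] // Su]; first exact: leey.
    by exfalso; apply: unbd; exists u.
  by exfalso; apply: unbd; exists 0%R => x /Su; rewrite leeNy_eq => /eqP ->.
have [[n0 Sn0]|nofin] := pselect (exists n : int, S n%:E); last first.
  exists -oo; split=> [[n||] Sx|u _]; rewrite ?leNye //.
    by exfalso; apply: nofin; exists n.
  by have := SB _ Sx.
have exk : exists k : nat, `[< S (B - k%:Z)%R%:E >].
  exists `|B - n0|%N; apply/asboolP.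
  have n0B : (n0 <= B)%R by have := SB _ Sn0; rewrite lee_fin.
  by rewrite gez0_abs ?subr_ge0// subKr.
case: (ex_minnP exk) => k /asboolP Sk kmin; exists (B - k%:Z)%R%:E.
split=> [[n||] Sx|u]; rewrite ?leNye //; last by apply.
  have nB : (n <= B)%R by have := SB _ Sx; rewrite lee_fin.
  have absE : Posz `|B - n| = (B - n)%R by rewrite gez0_abs ?subr_ge0.
  have := kmin `|B - n|%N; rewrite absE subKr => /(_ (asboolT Sx)).
  by rewrite -lez_nat absE lee_fin lerBrDl lerBrDr.
by have := SB _ Sx.
Qed.

Lemma dual_residual_exists (a y : counter) :
  dual_residual_dom a y -> exists x, is_dual_residual y a x.
Proof.
move=> Cy; pose S := [set z : counter | counter_le y (hadamard a z)].
pose V t := [set v | exists2 z, S z & v = z t].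
pose x t := projT1 (cid (bar_int_lub (V t))).
have xub t z : S z -> z t <= x t.
  by move=> Sz; rewrite /x; case: cid => m [/= ub _]; apply: ub; exists z.
have xlub t u : (forall z, S z -> z t <= u) -> x t <= u.
  by rewrite /x; case: cid => m [/= _ lub] H; apply: lub => _ [z Sz ->]; exact: H.
have Sbot : S (monomial -oo +oo).
  move=> t; rewrite /= /hadamard_fun /= leey.
  case: (a t%:E) (Cy t) => [n||] Cyt; rewrite ?leNye //.
  by rewrite Cyt //; right.
have xmono t u : t <= u -> x t <= x u.
  move=> tu; apply: xlub => z Sz; apply: le_trans (xub _ _ Sz).
  exact: counter_nondecreasing.
have xNy : x -oo = -oo.
  by apply/eqP; rewrite -leeNy_eq; apply: xlub => z _; rewrite counterNy.
have xy : x +oo = +oo.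
  by apply/eqP; rewrite -leye_eq; apply: le_trans (xub _ _ Sbot).
exists (Counter xmono xNy xy); split=> [t|z Sz t]; last exact: xub.
rewrite /= /hadamard_fun /=.
have [afin|ainf] := boolP (a t%:E \is a fin_num).
  rewrite -DualAddTheoryRealDomain.lee_dsubr_addl //; apply: xlub => z Sz.
  by rewrite DualAddTheoryRealDomain.lee_dsubr_addl //; exact: Sz.
rewrite Cy ?leey //; move: ainf.
by case: (a t%:E) => [?||] //; [right|left].
Qed.

(* y (.)^flat a, with [None] when undefined; [is_dual_residual y a] determines
   at most one counter. *)
Definition dual_residual (y a : counter) : option counter :=
  match pselect (dual_residual_dom a y) with
  | left Cy => Some (projT1 (cid (dual_residual_exists Cy)))
  | right _ => None
  end.

(* Main.v *)
Require Import Defs.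
From mathcomp Require Import all_boot all_order all_algebra.
From mathcomp Require Import boolp classical_sets constructive_ereal.

Import Order.TTheory GRing.Theory Num.Theory.

(** The order on counters is reversed, so the residual is the pointwise largest [z] with
    [nu' + z t <= nu] for [t <= tau]; beyond [tau] nothing is constrained. If [tau <= tau'], the
    adjunction between addition and subtraction of a finite [nu'] gives the bound [nu - nu']. If
    [tau' < tau], some integer in between makes [r'] infinite while [r] is [nu], which leaves the
    domain. *)

Lemma counter_eq (s1 s2 : counter) :
  (forall t : int, s1 t%:E = s2 t%:E) -> s1 = s2.
Proof.
case: s1 s2 => [f fle fNy fy] [g gle gNy gy] /= fg.
have efg : f = g by apply/funext => -[t||]; rewrite ?fg ?fNy ?gNy ?fy ?gy.
by subst g; congr Counter; apply: Prop_irrelevance.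
Qed.

Lemma dual_residual_unique (y a x1 x2 : counter) :
  is_dual_residual y a x1 -> is_dual_residual y a x2 -> x1 = x2.
Proof.
move=> [ax1 least1] [ax2 least2]; apply: counter_eq => t.
by apply/eqP; rewrite eq_le least2 // least1.
Qed.

(** Uniqueness of the least counter makes the witness picked by [cid] irrelevant. *)
Lemma dual_residual_some (y a x : counter) :
  dual_residual_dom a y -> is_dual_residual y a x ->
  dual_residual y a = Some x.
Proof.
move=> Cy xP; rewrite /dual_residual; case: pselect => // Cy'.
by case: cid => x' /= /dual_residual_unique -/(_ _ xP) ->.
Qed.

Lemma dual_residual_none (y a : counter) :
  ~ dual_residual_dom a y -> dual_residual y a = None.
Proof. by move=> nCy; rewrite /dual_residual; case: pselect. Qed.

Lemma bar_int_lt_witness (u v : \bar int) :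
  (u < v)%E -> exists2 t : int, (u < t%:E)%E & (t%:E <= v)%E.
Proof.
case: v => [v||] uv; [by exists v| |by rewrite ltNge leNye in uv].
case: u uv => [u||] uv; [|by rewrite ltxx in uv|].
  by exists (u + 1)%R; rewrite ?leey // lte_fin ltrDl.
by exists 0%R; rewrite ?leey ?ltNye.
Qed.

Theorem proposition3p9 (nu tau nu' tau' : \bar int)
    (hnu : nu = +oo%E -> (tau <= tau')%E)
    (hnu' : [\/ nu' \is a fin_num, nu = +oo%E, tau = -oo%E | (tau' < tau)%E]) :
  dual_residual (monomial nu tau) (monomial nu' tau') =
  if (tau <= tau')%E then Some (monomial (nu - nu')%dE tau) else None.
Proof.
case: leP => [le_tau|lt_tau]; last first.
  apply: dual_residual_none => Cy.
  have [t tau't ttau] := bar_int_lt_witness _ _ lt_tau.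
  (* At this [t], [r'] is [+oo], so the domain condition forces [r t], that is [nu], to be [+oo]. *)
  have /hnu : nu = +oo%E.
    by have := Cy t; rewrite /= ttau leNgt tau't /=; apply; right.
  by rewrite leNgt lt_tau.
(* An integer [t <= tau] rules out [tau = -oo]. *)
have fin_or_top t : (t%:E <= tau)%E -> nu' \is a fin_num \/ nu = +oo%E.
  case: hnu' => [nu'fin|nuy|->|]; [by left|by right| |by rewrite ltNge le_tau].
  by rewrite leNgt ltNye.
apply: dual_residual_some => [t|].
  move=> /= ainf; case: ifP => // ttau; rewrite (le_trans ttau le_tau) in ainf.
  by case: (fin_or_top t ttau) => // nu'fin; case: ainf nu'fin => ->.
split=> [t|z az t] /=.
  case: ifP => ttau; last exact: leey.
  rewrite /hadamard_fun /= ttau (le_trans ttau le_tau).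
  case: (fin_or_top t ttau) => [nu'fin|->]; last exact: leey.
  by rewrite -DualAddTheoryRealDomain.lee_dsubr_addl.
case: ifP => ttau; last exact: leey.
(* In dual addition [+oo - nu'] is [+oo] for every [nu'], including [+oo]. *)
case: (fin_or_top t ttau) => [nu'fin|->]; last by case: (nu') => *; exact: leey.
rewrite DualAddTheoryRealDomain.lee_dsubr_addl //.
by have := az t; rewrite /= /hadamard_fun /= ttau (le_trans ttau le_tau).
Qed.
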